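(* For positive integers $b$ and $n$, the number of minimal crossing juggling card sequences with $b$ balls and $n$ cards is \[ f(n,b)=\frac1b\binom{n-1}{b-1}\binom{n}{b-1}=\frac1n\binom{n}{b}\binom{n}{b-1}, \] the Narayana numbers.
   Context: There are $b$ balls on levels $1,\dots,b$. For $1\le i\le b$ the card $C_i$ induces the permutation $\pi_{C_i}$ of $[b]$ with $\pi_{C_i}(1)=i$, $\pi_{C_i}(j)=j-1$ for $2\le j\le i$, $\pi_{C_i}(j)=j$ for $j>i$. For a juggling card sequence $A=C_{i_1}\cdots C_{i_n}$ (cards from $\{C_1,\dots,C_b\}$), $\pi_A=\pi_{C_{i_n}}\circ\cdots\circ\pi_{C_{i_1}}$ (the final level of the ball starting at level $j$ is $\pi_A(j)$), and the number of crossings is $Cr(A)=\sum_{k=1}^n(i_k-1)$. A minimal crossing juggling card sequence with $b$ balls is a juggling card sequence with cards from $\{C_1,\dots,C_b\}$ that uses the card $C_b$ at least once, has $\pi_A=\mathrm{id}$, and has $Cr(A)=b(b-1)$. *)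

(* Defs.v *)
From mathcomp Require Import all_boot all_order all_fingroup all_algebra.

Set Implicit Arguments.
Unset Strict Implicit.
Unset Printing Implicit Defensive.

Local Open Scope group_scope.

(* Levels and cards are numbered from 0: the element of 'I_b with value i      *)
(* stands for the level i + 1, and also for the card C_(i+1).                  *)

Definition pred_level b (j : 'I_b) : 'I_b :=
  Ordinal (leq_ltn_trans (leq_pred j) (ltn_ord j)).

Definition card_map b (i j : 'I_b) : 'I_b :=
  if j == 0 :> nat then i else if j <= i then pred_level j else j.

Lemma card_map_inj b (i : 'I_b) : injective (card_map i).
Proof.
move=> [[|j] hj] [[|k] hk]; rewrite /card_map /= => /(congr1 val) /= e;
  apply: val_inj => //=; move: e; case: i => i hi /=.
- by case: ltnP => /= h e; rewrite e ltnn in h.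
- by case: ltnP => /= h e; rewrite -e ltnn in h.
case: ltnP => hji; case: ltnP => hki /= e; first by rewrite e.
- by rewrite e ltnNge (leqW hki) in hji.
- by rewrite -e ltnNge (leqW hji) in hki.
- by [].
Qed.

Definition card_perm b (i : 'I_b) : 'S_b := perm (@card_map_inj b i).

(* In 'S_b, (s * t) x = t (s x), so that the first card of A acts first.       *)
Definition seq_perm b n (A : n.-tuple 'I_b) : 'S_b :=
  \prod_(k < n) card_perm (tnth A k).

(* C_i makes i - 1 crossings, which is the value of its 0-based index.         *)
Definition crossings b n (A : n.-tuple 'I_b) : nat :=
  (\sum_(k < n) tnth A k)%N.

Definition minimal_crossing b n (A : n.-tuple 'I_b) : bool :=
  [&& [exists k : 'I_n, (tnth A k).+1 == b],
      seq_perm A == 1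
    & crossings A == (b * b.-1)%N].

Definition num_minimal_crossing n b : nat :=
  #|[set A : n.-tuple 'I_b | minimal_crossing A]|.

(* Main.v *)
(* Record, for each card, the ball that it throws, balls being named by their
   final levels. Read backwards, the levels follow the move-to-front rule, so
   every word in the balls comes from exactly one card sequence, and at any time
   the balls are ordered by their next throws. A pair x < y crosses once for each
   alternation of x and y in the word followed by x; hence, when every ball is
   thrown and the permutation is the identity, it crosses at least twice, and
   exactly twice iff y x y is not a subsequence. Minimal sequences thus correspond to
   the words in which the balls first appear in the order 1, ..., b and which
   avoid y x y for x < y, that is, to noncrossing partitions of [n] into b blocks.
   Scanning such a word from left to right, the letters that may be reused form a
   stack; counting by the height d of the stack and the number p of letters still
   to appear gives C(m, p) C(m+d-1, p+d-1) - C(m, p-1) C(m+d-1, p+d) words of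
   length m. *)

Require Import Defs.
From mathcomp Require Import all_boot all_order all_fingroup all_algebra.
From mathcomp Require Import zify.

Import GRing.Theory.
Local Open Scope ring_scope.

Set Implicit Arguments.
Unset Strict Implicit.

(** * From card sequences to words in the balls *)

Section Words.
Local Open Scope nat_scope.
Local Open Scope group_scope.
Variable b : nat.
Implicit Types (s w st : seq 'I_b) (i j k x y z : 'I_b).

(* Qualified because perm.v also has a [card_perm]. *)
Definition card_prod s : 'S_b := \prod_(i <- s) Defs.card_perm i.

(** The thrown ball lands on level [i]; the remaining cards carry it from there to its final level,
    which is its name. *)
Fixpoint ball_word s : seq 'I_b :=
  if s is i :: s' then card_prod s' i :: ball_word s' else [::].

(* The ball thrown sooner is lower; balls that are not thrown any more are
   already in their final order. *)
Definition prec w x y : bool :=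
  (index x w < index y w)%N || (index x w == index y w) && (x < y)%N.

Lemma prec_cons z w x y :
  prec (z :: w) x y = (z != y) && ((z == x) || prec w x y).
Proof.
rewrite /prec /=; case: (eqVneq z x) => [<-|zx]; case: (eqVneq z y) => [<-|zy] //=.
by rewrite ltnn.
Qed.

Lemma card_prod_cons i s j :
  card_prod (i :: s) j = card_prod s (card_map i j).
Proof. by rewrite /card_prod big_cons permM permE. Qed.

Lemma card_map_eq i j : (i == card_map i j) = (j == 0 :> nat).
Proof.
rewrite /card_map -val_eqE; case: (eqVneq (j : nat) 0%N) => [|j0] //=.
  by rewrite eqxx.
by case: leqP => /= h; apply/eqP; lia.
Qed.

Lemma card_map_mono i j k : j != 0 :> nat -> k != 0 :> nat ->
  (card_map i j < card_map i k)%N = (j < k)%N.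
Proof.
rewrite /card_map => /negbTE j0 /negbTE k0; rewrite j0 k0.
by case: (leqP j i); case: (leqP k i) => /= *; lia.
Qed.

(** Level 0 holds the ball thrown next, and a card keeps the relative order of all other balls. *)
Lemma prec_level s j k :
  prec (ball_word s) (card_prod s j) (card_prod s k) = (j < k)%N.
Proof.
elim: s j k => [|i s IH] j k.
  by rewrite /card_prod big_nil !perm1.
rewrite !card_prod_cons /= prec_cons !(inj_eq perm_inj) !card_map_eq IH.
case: (eqVneq (k : nat) 0%N) => [->|k0] //=.
case: (eqVneq (j : nat) 0%N) => [->|j0] /=; first by lia.
exact: card_map_mono.
Qed.

Lemma level_sum i : (i = \sum_(j : 'I_b) (j < i) :> nat)%N.
Proof.
transitivity (\sum_(j < b | j < i) 1)%N; last first.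
  by rewrite big_mkcond; apply: eq_bigr => j _; case: ltnP.
by rewrite (big_ord_narrow (ltnW (ltn_ord i))) sum1_card card_ord.
Qed.

Lemma level_sum_prec s i :
  (i = \sum_x prec (ball_word s) x (card_prod s i) :> nat)%N.
Proof.
rewrite [LHS]level_sum [RHS](reindex_inj (@perm_inj _ (card_prod s))) /=.
by apply: eq_bigr => j _; rewrite prec_level.
Qed.

Lemma card_prod_eq1 s :
  reflect (forall x y, prec (ball_word s) x y = (x < y)%N) (card_prod s == 1).
Proof.
apply: (iffP eqP) => [s1 x y|H].
  by have := prec_level s x y; rewrite s1 !perm1.
apply/permP => i; rewrite perm1; apply: val_inj => /=.
(* A level is the number of balls that precede, so [prec] determines the permutation. *)
rewrite [RHS](level_sum_prec s) [LHS]level_sum.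
by apply: eq_bigr => x _; rewrite H.
Qed.

Lemma ball_word_inj s t : ball_word s = ball_word t -> s = t.
Proof.
elim: s t => [|i s IH] [|j t] //= [e /IH st]; subst t.
by rewrite (perm_inj e).
Qed.

Lemma size_ball_word s : size (ball_word s) = size s.
Proof. by elim: s => //= i s ->. Qed.

(* After its last throw the ball that ends on the top level stays there, so that
   throw uses the top card. *)
Lemma mem_ball_word_last s x : x.+1 = b -> (x \in ball_word s) = (x \in s).
Proof.
move=> xb; elim: s => //= i s IH; rewrite !inE IH.
case: (boolP (x \in s)) => xs; first by rewrite !orbT.
rewrite !orbF; suff {1}-> : x = card_prod s x by rewrite (inj_eq perm_inj).
pose l := (card_prod s)^-1 x.
have xE : card_prod s l = x by rewrite /l permKV.
suff xl : x = l by rewrite {2}xl xE.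
have := prec_level s l x; rewrite xE /prec.
have -> : index x (ball_word s) = size (ball_word s).
  by apply: memNindex; rewrite IH.
have := index_size (card_prod s x) (ball_word s).
rewrite ltnNge => -> /=.
have -> : (x < card_prod s x)%N = false by apply/negbTE; have := ltn_ord (card_prod s x); lia.
rewrite andbF => /esym/negbT; rewrite -leqNgt => h.
by apply: val_inj => /=; have := ltn_ord l; lia.
Qed.

(** * Crossings pair by pair *)

(** A throw passes the other ball of the pair exactly when that ball is lower afterwards, that is,
    precedes [z] in the rest [w]. *)
Definition cost_step w z x y : nat := (z == x) && prec w y x || (z == y) && prec w x y.

Fixpoint pair_cost w x y : nat :=
  if w is z :: w' then (cost_step w' z x y + pair_cost w' x y)%N else 0%N.

Lemma crossings_ball_word s :
  (\sum_(i <- s) i = \sum_(x : 'I_b) \sum_(y : 'I_b | x < y) pair_cost (ball_word s) x y)%N.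
Proof.
elim: s => [|i s IH].
  by rewrite big_nil big1 // => x _; rewrite big1.
rewrite big_cons IH /=; set w := ball_word s; set z := card_prod s i.
under [RHS]eq_bigr do rewrite big_split.
rewrite big_split /=; congr (_ + _)%N.
rewrite {1}(level_sum_prec s i) -/w -/z.
have -> : (\sum_(x : 'I_b) \sum_(y : 'I_b | x < y) cost_step w z x y =
   \sum_(x : 'I_b) \sum_(y : 'I_b | x < y) ((z == x) * prec w y x) + 
   \sum_(x : 'I_b) \sum_(y : 'I_b | x < y) ((z == y) * prec w x y))%N.
  rewrite -big_split; apply: eq_bigr => x _ /=.
  rewrite -big_split; apply: eq_bigr => y xy /=; rewrite /cost_step.
  have [zx|_] := eqVneq z x; have [zy|_] := eqVneq z y => //=.
  - by move: xy; rewrite -zx -zy ltnn.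
  - by rewrite orbF mul1n addn0.
  - by rewrite mul1n.
have -> : (\sum_(x : 'I_b) \sum_(y : 'I_b | x < y) ((z == x) * prec w y x) =
   \sum_(y : 'I_b | z < y) prec w y z)%N.
  rewrite (bigD1 z) //= [X in (_ + X)%N]big1 ?addn0.
    by apply: eq_bigr => y _; rewrite eqxx mul1n.
  by move=> x /negbTE xz; rewrite big1 // => y _; rewrite eq_sym xz.
have -> : (\sum_(x : 'I_b) \sum_(y : 'I_b | x < y) ((z == y) * prec w x y) =
   \sum_(x : 'I_b | x < z) prec w x z)%N.
  rewrite (exchange_big_dep predT) //= (bigD1 z) //= [X in (_ + X)%N]big1 ?addn0.
    by apply: eq_bigr => x _; rewrite eqxx mul1n.
  by move=> y /negbTE yz; rewrite big1 // => x _; rewrite eq_sym yz.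
rewrite [X in (X + _)%N]big_mkcond [X in (_ + X)%N]big_mkcond -big_split; apply: eq_bigr => x _ /=.
case: (ltngtP z x) => //= [|/val_inj <-]; rewrite ?addn0 //.
by rewrite /prec ltnn ltnn andbF.
Qed.

Lemma cost_stepE w z x y : (x < y)%N ->
  cost_step w z x y = ((z == x) && prec w y x || (z == y) && ~~ prec w y x) :> nat.
Proof.
move=> xy; rewrite /cost_step; congr (nat_of_bool (_ || _ && _)).
have xy' : (y < x)%N = false by lia.
by rewrite /prec xy xy' andbT andbF orbF -leqNgt [RHS]leq_eqVlt orbC.
Qed.

Lemma subseq_prec w x y : y \in w -> x != y -> ~~ prec w y x -> subseq [:: x; y] w.
Proof.
elim: w => //= z w IH; rewrite inE prec_cons.
case: (eqVneq x z) => [<-|zx].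
  by move=> + xy _; rewrite eq_sym (negbTE xy) /= sub1seq.
by rewrite eq_sym in zx; case: (eqVneq y z) => //= yz yw xy; rewrite zx; apply: IH.
Qed.

Lemma prec_subseq w x y : y != x -> (x < y)%N ->
  prec w y x -> subseq [:: x; y] w -> subseq [:: y; x; y] w.
Proof.
move=> yx xy; elim: w => //= z w IH; rewrite prec_cons.
rewrite [x == z]eq_sym; case: (eqVneq z x) => //= zx.
by rewrite [y == z]eq_sym; case: (eqVneq z y).
Qed.

(** Keep only [x] and [y] and append [x]: the cost counts alternations. If [y] occurs there is at
    least one, and at least two if [x] comes first; exceeding this minimum takes a subsequence y x
    y. *)
Lemma pair_cost_bound w x y : (x < y)%N ->
  if y \in w then
    let c := if prec w y x then 1%N else 2 in
    (c <= pair_cost w x y)%N /\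
    (pair_cost w x y == c) = ~~ subseq [:: y; x; y] w
  else (pair_cost w x y = 0%N) /\ ~~ prec w y x.
Proof.
move=> xy; have xny : x != y by rewrite -val_eqE /= ltn_eqF.
have ynx : y != x by rewrite eq_sym.
elim: w => [|z w IH] /=.
  by split => //; rewrite /prec /= -leqNgt ltnW.
rewrite cost_stepE // prec_cons inE.
case: (eqVneq z x) => [->|zx] /=.
  rewrite (negbTE ynx) /= (negbTE xny) /= orbF.
  case: ifP IH => yw.
    by case: (prec w y x) => /= -[h1 <-]; split; lia.
  by case=> -> /negbTE ->.
rewrite [y == z]eq_sym; case: (eqVneq z y) => [zy|zy] /=; last by rewrite add0n.
case: ifP IH => yw; last first.
  case=> -> ->; split => //=; apply/esym/negP => /mem_subseq /(_ y).
  by rewrite yw !inE eqxx orbT => /(_ isT).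
case: ifP => /= pw [h1 h2].
  rewrite add0n; split => //; rewrite h2; congr (~~ _); apply/idP/idP.
    by move/(subseq_trans (subseq_cons [:: x; y] y)).
  exact: prec_subseq.
split; first lia.
by rewrite (subseq_prec yw xny) ?pw //; lia.
Qed.

(** * Minimal sequences as noncrossing words *)

Definition noncrossing_word w : Prop :=
  [/\ forall y, y \in w,
      forall x y, (x < y)%N -> (index x w < index y w)%N
    & forall x y, (x < y)%N -> ~~ subseq [:: y; x; y] w].

Lemma sum_lt_pairs : (\sum_(x : 'I_b) \sum_(y : 'I_b | x < y) 2 = b * b.-1)%N.
Proof.
rewrite (exchange_big_dep predT) //=.
transitivity (\sum_(y < b) y * 2)%N.
  apply: eq_bigr => y _.
  by rewrite (big_ord_narrow (ltnW (ltn_ord y))) sum_nat_const card_ord.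
by rewrite -big_distrl /= -(big_mkord predT id) bin2_sum mulnC mul_bin_left bin1 subn1 mulnC.
Qed.

Lemma noncrossing_cost w :
    (forall y, y \in w) -> (forall x y, (x < y)%N -> (index x w < index y w)%N) ->
  (\sum_(x : 'I_b) \sum_(y : 'I_b | x < y) pair_cost w x y == b * b.-1)%N =
  [forall x : 'I_b, forall (y : 'I_b | (x < y)%N), ~~ subseq [:: y; x; y] w].
Proof.
move=> all_in rgf; rewrite -sum_lt_pairs eq_sym.
(* Each pair costs at least 2, so the total is minimal exactly when every pair is. *)
have H : (\sum_(x : 'I_b) \sum_(y : 'I_b | x < y) 2 <=
   \sum_(x : 'I_b) \sum_(y : 'I_b | x < y) pair_cost w x y ?= iff
  [forall x : 'I_b, forall (y : 'I_b | (x < y)%N), ~~ subseq [:: y; x; y] w])%N.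
  apply: leqif_sum => x _; apply: leqif_sum => y xy.
  have := pair_cost_bound w xy; rewrite all_in.
  have -> : prec w y x = false.
    by rewrite /prec; have := rgf _ _ xy; case: ltngtP.
  by case=> h1 h2; split; rewrite // eq_sym h2.
by case: H.
Qed.

Lemma minimal_crossingP n (A : n.-tuple 'I_b) : (0 < b)%N ->
  reflect (noncrossing_word (ball_word A)) (minimal_crossing A).
Proof.
move=> b0; pose z : 'I_b := Ordinal (etrans (congr1 (leq^~ b) (prednK b0)) (leqnn b)).
have zb : z.+1 = b by rewrite /= prednK.
have -> : minimal_crossing A = [&& z \in ball_word A, card_prod A == 1%g
    & \sum_(x : 'I_b) \sum_(y : 'I_b | x < y) pair_cost (ball_word A) x y == b * b.-1]%N.
  rewrite /minimal_crossing mem_ball_word_last // -crossings_ball_word.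
  rewrite /crossings /seq_perm -!(big_tuple _ _ A predT) -/(card_prod A).
  congr (_ && _); apply/existsP/tnthP => -[k].
    by move=> /eqP kb; exists k; apply: val_inj => /=; move: (tnth A k) kb => u; lia.
  by move=> zk; exists k; rewrite -zk zb.
set w := ball_word A; apply: (iffP and3P) => [[zw /card_prod_eq1 ord cost]|[all_in rgf nsub]].
  (* If [y] is never thrown, [prec] can put it before the top ball [z] only when [z] is not thrown
     either. *)
  have all_in y : y \in w.
    apply: contraTT zw => yw.
    have := ord y z; rewrite -/w /prec (memNindex yw).
    rewrite ltnNge index_size /=; case: (eqVneq y z) => [<-//|yz].
    have -> : (y < z)%N.
      by move: yz; rewrite -val_eqE /=; have := ltn_ord y; lia.
    by rewrite andbT -index_mem -leqNgt => /eqP <-.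
  have rgf x y : (x < y)%N -> (index x w < index y w)%N.
    move=> xy; have := ord x y; rewrite -/w /prec xy andbT.
    case: ltngtP => // /(congr1 (nth x w)); rewrite !nth_index // => e.
    by rewrite e ltnn in xy.
  split => // x y xy; rewrite noncrossing_cost // in cost.
  by move/forallP/(_ x)/forallP/(_ y)/implyP: cost; apply.
split=> //.
  apply/card_prod_eq1 => x y; rewrite -/w /prec.
  case: (ltngtP x y) => [xy|yx|/val_inj ->].
  - by rewrite rgf.
  - by rewrite andbF orbF ltnNge ltnW // rgf.
  - by rewrite ltnn eqxx.
rewrite noncrossing_cost //; apply/forallP => x; apply/forallP => y.
by apply/implyP; apply: nsub.
Qed.

(** * Scanning words with a stack *)

(* [p] is the number of letters already used and [st] lists, in decreasing
   order, those that may be used again without creating a pattern y x y. *)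
Fixpoint scan (p : nat) st w : bool :=
  if w is z :: w' then
    if z == p :> nat then scan p.+1 (z :: st) w'
    else (z \in st) && scan p [seq x : 'I_b <- st | (x <= z)%N] w'
  else p == b.

(** The noncrossing conditions on the unread part [w]; in the last clause the first [y] of y x y has
    already been read. *)
Definition scannable p st w : Prop :=
  [/\ forall z, z \in w -> (z < p)%N -> z \in st,
      forall y, (p <= y)%N -> y \in w,
      forall x y, (p <= x)%N -> (x < y)%N -> (index x w < index y w)%N,
      forall x y, (x < y)%N -> ~~ subseq [:: y; x; y] w
    & forall x y, (x < y)%N -> (y < p)%N -> ~~ subseq [:: x; y] w].

(** A new letter must be [p], since first occurrences come in order; reusing [z] bars the larger
    used letters, which would complete a pattern y z y. *)
Lemma scanP p st w : (p <= b)%N -> (forall z, z \in st -> (z < p)%N) ->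
  scan p st w <-> scannable p st w.
Proof.
elim: w p st => [|z w IH] p st pb stp /=.
  split=> [/eqP pE|[_ all_in _ _ _]].
    split=> // [y|x y]; first by rewrite pE leqNgt ltn_ord.
    by move=> px xy; have := ltn_ord x; lia.
  rewrite eqn_leq pb leqNgt; apply/negP => bp.
  by have := all_in (Ordinal bp) (leqnn _).
case: (eqVneq (z : nat) p) => [zp|zp].
  have H u : u \in z :: st -> (u < p.+1)%N.
    by rewrite inE => /orP[/eqP ->|/stp /ltnW //]; rewrite zp.
  have zb : (p < b)%N by rewrite -zp.
  rewrite (IH _ _ zb H); split => -[h1 h2 h3 h4 h5]; split.
  - move=> u; rewrite inE => /orP[/eqP ->|uw up]; first by rewrite zp ltnn.
    have := h1 u uw (ltnW up); rewrite inE -val_eqE /= zp => /orP[/eqP up'|//].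
    by rewrite up' ltnn in up.
  - move=> y; rewrite leq_eqVlt inE => /orP[/eqP py|/h2 ->]; last by rewrite orbT.
    by rewrite -val_eqE /= zp py eqxx.
  - move=> x y; rewrite leq_eqVlt => /orP[/eqP px|px] xy /=.
      have -> : z == x by rewrite -val_eqE /= zp px.
      by have -> : z == y = false by rewrite -val_eqE /=; lia.
    have -> : z == x = false by rewrite -val_eqE /=; lia.
    have -> : z == y = false by rewrite -val_eqE /=; lia.
    by rewrite ltnS h3.
  - move=> x y xy /=; case: (eqVneq y z) => [yz|_]; last exact: h4.
    by apply: h5; rewrite // yz zp.
  - move=> x y xy yp /=; case: (eqVneq x z) => [xz|_]; first by move: xy; rewrite xz; lia.
    by apply: h5; rewrite // ltnW.
  - move=> u uw; rewrite ltnS leq_eqVlt => /orP[up|up].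
      by rewrite inE -val_eqE /= zp up.
    by rewrite inE h1 ?orbT // inE uw orbT.
  - move=> y py; have := h2 y (ltnW py); rewrite inE -val_eqE /= zp => /orP[/eqP|//].
    by move=> e; rewrite e ltnn in py.
  - move=> x y px xy; have /= := h3 x y (ltnW px) xy.
    have -> : z == x = false by rewrite -val_eqE /=; lia.
    by have -> : z == y = false by rewrite -val_eqE /=; lia.
  - move=> x y xy; have /= := h4 x y xy; case: eqVneq => // -> /negP h.
    by apply/negP => /(subseq_trans (subseq_cons [:: x; z] z)).
  - move=> x y xy; rewrite ltnS leq_eqVlt => /orP[/eqP yp|yp].
      have yz : y = z by apply: val_inj; rewrite /= yp zp.
      by have /= := h4 x y xy; rewrite yz eqxx.
    have /= := h5 x y xy yp; case: eqVneq => // xz.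
    by move: xy; rewrite xz zp ltnNge ltnW.
have stz u : (u \in [seq x : 'I_b <- st | (x <= z)%N]) = (u <= z)%N && (u \in st).
  by rewrite mem_filter.
have H u : u \in [seq x : 'I_b <- st | (x <= z)%N] -> (u < p)%N.
  by rewrite stz => /andP[_ /stp].
split.
  case/andP=> zst /(IH _ _ pb H) -[h1 h2 h3 h4 h5]; have zltp := stp _ zst; split.
  - move=> u; rewrite inE => /orP[/eqP -> //|uw up].
    by have := h1 u uw up; rewrite stz => /andP[].
  - by move=> y /h2 yw; rewrite inE yw orbT.
  - move=> x y px xy /=.
    have -> : z == x = false by rewrite -val_eqE /=; lia.
    have -> : z == y = false by rewrite -val_eqE /=; lia.
    by rewrite ltnS h3.
  - move=> x y xy /=; case: (eqVneq y z) => [yz|_]; last exact: h4.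
    by apply: h5; rewrite // yz.
  - move=> x y xy yp /=; case: (eqVneq x z) => [xz|_]; last exact: h5.
    rewrite sub1seq; apply/negP => yw; have := h1 y yw yp.
    by rewrite stz -xz leqNgt xy.
case=> h1 h2 h3 h4 h5.
have zltp : (z < p)%N.
  rewrite ltnNge; apply/negP => pz.
  have pz' : (p < z)%N by rewrite ltn_neqAle eq_sym zp.
  pose x : 'I_b := Ordinal (ltn_trans pz' (ltn_ord z)).
  by have /= := h3 x z (leqnn _) pz'; rewrite eqxx.
have zst : z \in st by rewrite h1 // inE eqxx.
rewrite zst /=; apply/(IH _ _ pb H); split.
- move=> u uw up; rewrite stz h1 ?andbT // ?inE ?uw ?orbT //.
  rewrite leqNgt; apply/negP => zu; have /= := h5 z u zu up.
  by rewrite eqxx sub1seq uw.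
- move=> y py; have := h2 y py; rewrite inE => /orP[/eqP e|//].
  by move: py; rewrite e leqNgt zltp.
- move=> x y px xy; have /= := h3 x y px xy.
  have -> : z == x = false by rewrite -val_eqE /=; lia.
  by have -> : z == y = false by rewrite -val_eqE /=; lia.
- move=> x y xy; have /= := h4 x y xy; case: eqVneq => // -> /negP h.
  by apply/negP => /(subseq_trans (subseq_cons [:: x; z] z)).
- move=> x y xy yp; have /= := h5 x y xy yp; case: eqVneq => // -> /negP h.
  by apply/negP => /(subseq_trans (subseq_cons [:: y] z)).
Qed.

Lemma scan_noncrossing w : scan 0 [::] w <-> noncrossing_word w.
Proof.
rewrite scanP //; split=> [[_ h2 h3 h4 _]|[h2 h3 h4]]; split=> //.
- by move=> y; apply: h2.
- by move=> x y; apply: h3.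
- by move=> x y _; apply: h3.
Qed.

End Words.

(** * Counting by stack height *)

(** Here [m] letters are to be read, [p] have yet to appear and the stack has height [d]; a new
    letter pushes, a reused one leaves a height from 1 to [d]. *)
Fixpoint narayana_walks (m p d : nat) : nat :=
  (if m is m'.+1 then
    (if p is q.+1 then narayana_walks m' q d.+1 else 0)
    + \sum_(j < d) narayana_walks m' p j.+1
  else p == 0)%N.

Section Counting.
Local Open Scope nat_scope.

Lemma sum_tuple_cons (T : finType) n (f : seq T -> nat) :
  \sum_(t : n.+1.-tuple T) f t = \sum_z \sum_(t : n.-tuple T) f (z :: t).
Proof.
rewrite pair_bigA /= (reindex (fun u : T * n.-tuple T => [tuple of u.1 :: u.2])) //=.
exists (fun t => (thead t, [tuple of behead t])) => [[z t] _|t _] /=.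
  by congr (_, _); apply: val_inj.
by rewrite [t in RHS]tuple_eta.
Qed.

(** Popping a decreasing stack down to each of its letters in turn yields each height from 1 to
    [size st] once. *)
Lemma sum_filter_le (b : nat) (st : seq 'I_b) (f : nat -> nat) :
  sorted (fun x y : 'I_b => y < x) st ->
  \sum_(z <- st) f (size [seq x <- st | (x : 'I_b) <= z]) =
  \sum_(j < size st) f j.+1.
Proof.
elim: st => [|a st IH] /=; first by rewrite big_nil big_ord0.
have gt_trans : transitive (fun x y : 'I_b => y < x).
  by move=> y x z /= yx zy; apply: ltn_trans zy yx.
rewrite (path_sortedE gt_trans) => /andP[/allP sta /IH {}IH].
rewrite big_cons leqnn big_ord_recr -IH addnC /=; congr (_ + f _.+1).
  rewrite !big_seq; apply: eq_bigr => z zst.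
  by rewrite leqNgt sta.
rewrite size_filter; apply/eqP; rewrite -all_count.
by apply/allP => u /sta /ltnW.
Qed.

Lemma card_scan (b n p : nat) (st : seq 'I_b) : p <= b ->
    (forall z, z \in st -> z < p) -> sorted (fun x y : 'I_b => y < x) st ->
  \sum_(t : n.-tuple 'I_b) scan p st t = narayana_walks n (b - p) (size st).
Proof.
elim: n p st => [|n IH] p st pb stp sst.
  rewrite (big_pred1 [tuple]) => [|t]; last by apply/esym/eqP; exact: (tuple0 t).
  by rewrite /= subn_eq0 eqn_leq pb.
rewrite (sum_tuple_cons n (fun t : seq 'I_b => scan p st t : nat)) /=.
have gt_trans : transitive (fun x y : 'I_b => y < x).
  by move=> y x z /= yx zy; apply: ltn_trans zy yx.
have ust : uniq st.
  by apply: sorted_uniq sst => // x; rewrite /= ltnn.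
transitivity (\sum_(z : 'I_b | z == p :> nat) narayana_walks n (b - p.+1) (size st).+1
  + \sum_(z in st) narayana_walks n (b - p) (size [seq x <- st | (x : 'I_b) <= z])).
  rewrite [X in X + _]big_mkcond [X in _ + X]big_mkcond -big_split /=.
  apply: eq_bigr => z _; case: (eqVneq (z : nat) p) => [zp|zp].
    have -> : z \in st = false by apply/negP => /stp; rewrite zp ltnn.
    rewrite addn0 IH //=; first by rewrite -zp.
      by move=> u; rewrite inE => /orP[/eqP ->|/stp /ltnW //]; rewrite zp.
    rewrite path_sortedE // sst andbT; apply/allP => u /stp.
    by rewrite zp.
  rewrite add0n; case: (boolP (z \in st)) => zst; last by rewrite big1.
  by rewrite IH ?sorted_filter // => u; rewrite mem_filter => /andP[_ /stp].
congr (_ + _); last first.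
  by rewrite -big_uniq // (sum_filter_le (narayana_walks n (b - p))).
case: (ltnP p b) => pb'.
  by rewrite (big_pred1 (Ordinal pb')) // -(subnSK pb').
rewrite big1 => [|z /eqP zp]; last by have := ltn_ord z; rewrite zp ltnNge pb'.
by have -> : b - p = 0 by apply/eqP; rewrite subn_eq0.
Qed.

Lemma num_minimal_crossingE n b : 0 < b ->
  num_minimal_crossing n b = narayana_walks n b 0.
Proof.
move=> b0; rewrite -[b in RHS]subn0 -(@card_scan b n 0 [::]) //.
have sz (A : n.-tuple 'I_b) : size (ball_word A) == n.
  by rewrite size_ball_word size_tuple.
pose W A : n.-tuple 'I_b := Tuple (sz A).
have Winj : injective W.
  by move=> A B /(congr1 val) /ball_word_inj /val_inj.
rewrite (reindex_inj Winj) /num_minimal_crossing -sum1dep_card big_mkcond /=.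
apply: eq_bigr => A _; have [scan_nc nc_scan] := scan_noncrossing (ball_word A).
by case: minimal_crossingP => // [/nc_scan ->|] //; case: scan scan_nc => // /(_ isT).
Qed.

(** Only reuse is possible, and raising [d] adds one term to its sum, as in Pascal's rule. *)
Lemma narayana_walks0 m d : narayana_walks m 0 d.+1 = 'C(m + d, d).
Proof.
elim: m d => [|m IH] d; first by rewrite binn.
elim: d => [|d IHd]; first by rewrite /= big_ord_recr big_ord0 /= IH !bin0.
move: IHd; rewrite /= => IHd; rewrite big_ord_recr /= addnA IHd IH.
by rewrite !addSn !addnS [RHS]binS addnC.
Qed.

(** The subtracted term of the closed form stands on the left, which avoids truncated
    subtraction. *)
Lemma narayana_walksS m k d :
  narayana_walks m k.+1 d.+1 + 'C(m, k) * 'C(m + d, k + d.+2) =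
  'C(m, k.+1) * 'C(m + d, k + d.+1).
Proof.
elim: m k d => [|m IH] k d.
  by rewrite /= (bin_small (_ : d < k + d.+2)) ?muln0 //; lia.
elim: d => [|d IHd].
  have := IH k 0; rewrite /= big_ord_recr big_ord0 /= add0n !addn0 !addn2 !addn1.
  (* For k = 0 the push leaves no letter to appear, so the other closed form applies. *)
  case: k {IH} (IH k.-1 1) => [_|k] /=.
    rewrite narayana_walks0 addn1 !binS !bin0; nia.
  rewrite addn1 addn2 addn3 !binS; nia.
(* One more level adds a single reuse term; the inner hypothesis accounts for the others. *)
move: IHd (IH k d.+1); rewrite /= !big_ord_recr /= .
case: k {IH} (IH k.-1 d.+1) (IH k.-1 d.+2) => [_ _|k] /=.
  rewrite !narayana_walks0 !add0n !addSn !addnS !binS !bin0; nia.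
rewrite !addSn !addnS !binS; nia.
Qed.

End Counting.

Theorem theorem4p2 (b n : nat) (hb : (0 < b)%N) (hn : (0 < n)%N) :
  (num_minimal_crossing n b)%:R
    = b%:R^-1 * 'C(n.-1, b.-1)%:R * 'C(n, b.-1)%:R :> rat
  /\
  (num_minimal_crossing n b)%:R
    = n%:R^-1 * 'C(n, b)%:R * 'C(n, b.-1)%:R :> rat.
Proof.
rewrite num_minimal_crossingE //; case: b hb => // k _; case: n hn => // m _ /=.
(* The stack starts empty, so the first letter is new and leaves height 1. *)
rewrite big_ord0 addn0.
have bN : (k.+1 * narayana_walks m k 1 = 'C(m, k) * 'C(m.+1, k))%N.
  case: k => [|k]; first by rewrite narayana_walks0 addn0 !bin0.
  have := narayana_walksS m k 0; rewrite !addn0 addn1 addn2 => H.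
  have := mul_bin_left m k; have := mul_bin_left m k.+1; rewrite binS.
  case: (leqP k.+1 m) => km; nia.
set N := narayana_walks m k 1 in bN *.
(* The second form follows from the first by m.+1 C(m, k) = k.+1 C(m.+1, k.+1), after cancelling
   [k.+1]. *)
have nN : (m.+1 * N = 'C(m.+1, k.+1) * 'C(m.+1, k))%N.
  apply/eqP; rewrite -(eqn_pmul2l (ltn0Sn k)) mulnCA bN mulnA mulnA.
  by rewrite mul_bin_diag.
have k0 : k.+1%:R != 0 :> rat by rewrite Num.Theory.pnatr_eq0.
have m0 : m.+1%:R != 0 :> rat by rewrite Num.Theory.pnatr_eq0.
split; rewrite -mulrA -natrM.
  by rewrite -bN natrM mulKf.
by rewrite -nN natrM mulKf.
Qed.
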